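(* Let $(U,P)\in\mathbb{R}^{d\times m}\times\mathbb{R}^{d\times m}$ be a given EIM pair with $P^\top U$ non-singular, and let $S$ be a given matrix of sample indices. Let $D=[D^{(1)}|\dots|D^{(p)}]\in\mathbb{R}^{d\times 2np}$ be the matrix of nonlinear terms with blocks $D^{(k)}=D_h(AZ_k)A\in\mathbb{R}^{d\times 2n}$, $k=1,\dots,p$, and let $C:=(P^\top U)^{-1}P^\top D$ and $R:=UC-D$. Let $D^*,C^*,R^*$ denote the restrictions of $D,C,R$ to a given set of $p^*\leq p$ sample parameters. If $U^{\mathrm{upd}}\in\mathbb{R}^{d\times m}$ is the full-rank update of the EIM basis $U$ obtained with these $p^*$ parameters, that is, $$S^\top U^{\mathrm{upd}}=S^\top U-S^\top R^*(C^* )^\dagger,\qquad \check{S}^\top U^{\mathrm{upd}}=\check{S}^\top U,$$ then $\lVert U^{\mathrm{upd}}C-D\rVert_F<\lVert UC-D\rVert_F$ if and only if $$\delta:=\lVert S^\top R\rVert_F^2-\lVert S^\top(R-R^*(C^* )^\dagger C)\rVert_F^2>0.$$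
   Context: Let $N,n,d,m,m_s,p$ be positive integers with $m\leq m_s\leq d$. $h:\mathbb{R}^{2N}\to\mathbb{R}^d$ is differentiable with Jacobian $D_h:\mathbb{R}^{2N}\to\mathbb{R}^{d\times 2N}$. The reduced basis $A\in\mathbb{R}^{2N\times 2n}$ satisfies $A^\top A=I_{2n}$ and $A^\top J_{2N}A=J_{2n}$, where $J_{2k}=\begin{pmatrix}0&I_k\\-I_k&0\end{pmatrix}$; $Z\in\mathbb{R}^{2n\times p}$ is a coefficient matrix with columns $Z_k$, one for each of the $p$ parameters $\eta_1,\dots,\eta_p$. EIM pair: $U\in\mathbb{R}^{d\times m}$ is the matrix whose columns are the $m$ EIM basis vectors, and $P=[\mathbf{e}_{j_1}|\dots|\mathbf{e}_{j_m}]\in\mathbb{R}^{d\times m}$ collects unit vectors of $\mathbb{R}^d$ at interpolation indices $\{j_1,\dots,j_m\}\subset\{1,\dots,d\}$. Sample indices: $S=[\mathbf{e}_{i_1}|\dots|\mathbf{e}_{i_{m_s}}]\in\mathbb{R}^{d\times m_s}$ for a set $\{i_1,\dots,i_{m_s}\}\subset\{1,\dots,d\}$ of $m_s$ distinct indices, and $\check{S}\in\mathbb{R}^{d\times(d-m_s)}$ has as columns the unit vectors of the remaining $d-m_s$ indices. Sample parameters: for a subset $\{\eta_{k_1},\dots,\eta_{k_{p^*}}\}\subset\{\eta_1,\dots,\eta_p\}$, $D^*=[D^{(k_1)}|\dots|D^{(k_{p^*})}]\in\mathbb{R}^{d\times 2np^*}$, $C^*=(P^\top U)^{-1}P^\top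 D^*\in\mathbb{R}^{m\times 2np^*}$ and $R^*=UC^*-D^*\in\mathbb{R}^{d\times 2np^*}$. $(\cdot)^\dagger$ is the Moore–Penrose pseudoinverse and $\lVert\cdot\rVert_F$ the Frobenius norm. *)

(* Defs.v *)
From HB Require Import structures.
From mathcomp Require Import all_boot all_order all_algebra.
From mathcomp Require Import all_classical all_reals all_analysis.

Set Implicit Arguments.
Unset Strict Implicit.
Unset Printing Implicit Defensive.

Import Order.TTheory GRing.Theory Num.Theory.
Import numFieldNormedType.Exports.

Local Open Scope classical_set_scope.
Local Open Scope ring_scope.

Definition symplectic_J {R : realType} (k : nat) : 'M[R]_(k + k) :=
  block_mx 0 1%:M (- 1%:M) 0.

(* [e_(f 0) | ... | e_(f (q - 1))], with e_i the unit vectors of R^d *)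
Definition unit_columns {R : realType} (d q : nat) (f : 'I_q -> 'I_d) :
    'M[R]_(d, q) :=
  colsub f 1%:M.

(* The library's ['J f p] is the matrix of the differential acting on row
   vectors (on the right), i.e. the transpose of the usual d x a Jacobian. *)
Definition Jacobian {R : realType} (a d : nat) (h : 'cV[R]_a -> 'cV[R]_d)
    (x : 'cV[R]_a) : 'M[R]_(d, a) :=
  ('J (fun u : 'rV[R]_a => (h u^T)^T) x^T)^T.

Definition frobenius {R : realType} (q r : nat) (M : 'M[R]_(q, r)) : R :=
  Num.sqrt (\sum_i \sum_j M i j ^+ 2).

Definition is_moore_penrose {R : realType} (q r : nat)
    (M : 'M[R]_(q, r)) (X : 'M[R]_(r, q)) : Prop :=
  [/\ M *m X *m M = M,
      X *m M *m X = X,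
      (M *m X)^T = M *m X &
      (X *m M)^T = X *m M].

(* Well defined: see [moore_penroseP] and [is_moore_penrose_unique]. Not to be
   confused with [pinvmx], which is only a partial inverse. *)
Definition moore_penrose {R : realType} (q r : nat) (M : 'M[R]_(q, r)) :
    'M[R]_(r, q) :=
  xget 0 [set X | is_moore_penrose M X].

Lemma is_moore_penrose_unique {R : realType} (q r : nat) (M : 'M[R]_(q, r))
    (X Y : 'M[R]_(r, q)) :
  is_moore_penrose M X -> is_moore_penrose M Y -> X = Y.
Proof.
move=> [X1 X2 X3 X4] [Y1 Y2 Y3 Y4].
have EXM : Y *m M = X *m M.
  by rewrite -Y4 -{1}X1 -(mulmxA M) mulmxA trmx_mul X4 Y4 mulmxA -(mulmxA X M)
             -(mulmxA X) Y1.
have EMX : M *m X = M *m Y.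
  by rewrite -X3 -{1}Y1 -mulmxA trmx_mul X3 Y3 mulmxA X1.
by rewrite -X2 -mulmxA EMX mulmxA -EXM Y2.
Qed.

Lemma row_free_gram {R : realType} (q r : nat) (M : 'M[R]_(q, r)) :
  row_free M -> M *m M^T \in unitmx.
Proof.
move=> fM; rewrite -row_free_unit; apply: inj_row_free => v v0.
have w0 : (v *m M) *m (v *m M)^T = 0.
  by rewrite trmx_mul mulmxA -(mulmxA v) v0 mul0mx.
apply/(row_free_inj fM); rewrite mul0mx; apply/rowP => j.
have /matrixP/(_ 0 0) := w0; rewrite mxE [RHS]mxE => /eqP.
under eq_bigr do rewrite [_^T _ _]mxE -expr2.
rewrite psumr_eq0 => [/allP/(_ j)|i _]; last exact: sqr_ge0.
by rewrite mem_index_enum sqrf_eq0 [RHS]mxE => /(_ isT)/eqP.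
Qed.

Lemma moore_penroseP {R : realType} (q r : nat) (M : 'M[R]_(q, r)) :
  is_moore_penrose M (moore_penrose M).
Proof.
rewrite /moore_penrose; case: xgetP => [X _ //|].
have := mulmx_base M; have := row_base_free M; have := col_base_full M.
move: (\rank M) (col_base M) (row_base M) => k B C fB fC EM.
have uC : C *m C^T \in unitmx by exact: row_free_gram.
have uB : B^T *m B \in unitmx.
  rewrite -{2}[B]trmxK; apply: row_free_gram.
  by rewrite /row_free mxrank_tr.
set G := invmx (C *m C^T); set H := invmx (B^T *m B).
have GT : G^T = G by rewrite /G trmx_inv trmx_mul trmxK.
have HT : H^T = H by rewrite /H trmx_inv trmx_mul trmxK.
set X := C^T *m G *m H *m B^T.
have MX : M *m X = B *m H *m B^T.
  by rewrite -EM /X -!mulmxA (mulmxA C) (mulmxA (C *m _)) mulmxV // mul1mx.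
have XM : X *m M = C^T *m G *m C.
  by rewrite -EM /X -!mulmxA (mulmxA B^T) (mulmxA H) mulVmx // mul1mx.
move=> /(_ X) []; split.
- by rewrite MX -[X in _ *m X = X]EM -!mulmxA (mulmxA B^T) (mulmxA H) mulVmx
             // mul1mx.
- by rewrite XM /X -!mulmxA (mulmxA C) (mulmxA (C *m _)) mulmxV // mul1mx.
- by rewrite MX !trmx_mul trmxK HT mulmxA.
- by rewrite XM !trmx_mul trmxK GT mulmxA.
Qed.

Lemma JacobianE {R : realType} (a d : nat) (h : 'cV[R]_a -> 'cV[R]_d)
    (x : 'cV[R]_a) i j :
  differentiable h x ->
  Jacobian h x i j = 'D_(delta_mx j 0) (fun y => h y i 0) x.
Proof.
move=> dh; pose g (u : 'rV[R]_a) := (h u^T)^T.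
have dtr q r (y : 'M[R]_(q, r)) : differentiable (@trmx R q r) y.
  apply/linear_differentiable => M.
  apply: ((@cvgrPdist_le _ _ _ (nbhs M) _ _ _).2 _) => e e0.
  have : nbhs M [set B | `|M - B| <= e].
    exact: (@cvgrPdist_le _ _ _ (nbhs M) _ id M).1 (@cvg_id _ (nbhs M)) e e0.
  apply: filterS => B; apply: le_trans; rewrite -linearB.
  rewrite [leLHS]/Num.Def.normr/= mx_normrE bigmax_le // => -[k l] _ /=.
  rewrite mxE [leRHS]/Num.Def.normr/= mx_normrE.
  exact: (le_bigmax _ (fun ij => `|(M - B) ij.1 ij.2|) (l, k)).
have dg : differentiable g x^T.
  apply: (differentiable_comp (g := @trmx R d 1)) => //.
  by apply: differentiable_comp => //; rewrite trmxK.
transitivity ('D_(delta_mx 0 j) g x^T 0 i).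
  by rewrite deriveEjacobian // -rowE !mxE.
rewrite derive_mx ?mxE; last exact: diff_derivable.
rewrite /derive; apply: (congr1 (fun f : R -> R => lim (f @ 0^'))).
apply/funext => k /=.
by rewrite /g !mxE [_^T]linearD [in LHS]linearZ /= trmx_delta trmxK.
Qed.

(* Main.v *)
(* Selecting the rows in S and the complementary rows splits the squared
   Frobenius norm. The update leaves the complementary rows of the residual
   unchanged, and turns its rows in S into those of R - R* (C* )^+ C, so delta is
   exactly the decrease of the squared error. *)

Require Import Defs.
From mathcomp Require Import all_boot all_order all_algebra.
From mathcomp Require Import all_classical all_reals all_analysis.
Import Order.TTheory GRing.Theory Num.Theory.
Import numFieldNormedType.Exports.
Local Open Scope ring_scope.

Lemma tr_unit_columns_mul {R : realType} {d q r : nat} (f : 'I_q -> 'I_d)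
    (M : 'M[R]_(d, r)) : (unit_columns f)^T *m M = rowsub f M.
Proof. by rewrite /unit_columns trmx_mxsub trmx1 mul_rowsub_mx mul1mx. Qed.

Lemma frobenius_ge0 {R : realType} {q r : nat} (M : 'M[R]_(q, r)) :
  0 <= frobenius M.
Proof. exact: sqrtr_ge0. Qed.

Lemma sqr_frobenius {R : realType} {q r : nat} (M : 'M[R]_(q, r)) :
  frobenius M ^+ 2 = \sum_i \sum_j M i j ^+ 2.
Proof.
by rewrite sqr_sqrtr// sumr_ge0// => i _; rewrite sumr_ge0// => j _; rewrite sqr_ge0.
Qed.

(** The squared norm is a sum over rows, and the images of [f] and [g] partition the row indices.
    Injectivity ensures that each row is counted once on the right-hand side. *)
Lemma sqr_frobenius_split {R : realType} {d q q' r : nat}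
    {f : 'I_q -> 'I_d} {g : 'I_q' -> 'I_d} (M : 'M[R]_(d, r)) :
    injective f -> injective g ->
    (forall i, (i \in codom g) = (i \notin codom f)) ->
  frobenius M ^+ 2 = frobenius ((unit_columns f)^T *m M) ^+ 2
                     + frobenius ((unit_columns g)^T *m M) ^+ 2.
Proof.
move=> f_inj g_inj fg; rewrite !tr_unit_columns_mul !sqr_frobenius.
rewrite (bigID (mem (codom f))) /=; congr (_ + _).
  (* Since [f] is injective, [codom f] is a duplicate-free list, so the sum over its members can be
     reindexed by the domain of [f]. *)
  rewrite -big_uniq /=; last exact/injectiveP.
  rewrite big_image /=.
  by apply: eq_bigr => i _; apply: eq_bigr => j _; rewrite mxE.
rewrite -(eq_bigl _ _ fg) -big_uniq /=; last exact/injectiveP.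
rewrite big_image /=.
by apply: eq_bigr => i _; apply: eq_bigr => j _; rewrite mxE.
Qed.

Theorem proposition2 (R : realType) (N n d m ms p ps : nat)
    (N_gt0 : (0 < N)%N) (n_gt0 : (0 < n)%N) (d_gt0 : (0 < d)%N)
    (m_gt0 : (0 < m)%N) (ms_gt0 : (0 < ms)%N) (p_gt0 : (0 < p)%N)
    (le_m_ms : (m <= ms)%N) (le_ms_d : (ms <= d)%N) (le_ps_p : (ps <= p)%N)
    (h : 'cV[R]_(N + N) -> 'cV[R]_d)
    (h_diff : forall x, differentiable h x)
    (A : 'M[R]_(N + N, n + n))
    (A_orth : A^T *m A = 1%:M)
    (A_sympl : A^T *m symplectic_J N *m A = symplectic_J n)
    (Z : 'M[R]_(n + n, p))
    (U : 'M[R]_(d, m)) (eim_idx : 'I_m -> 'I_d)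
    (idx : 'I_ms -> 'I_d) (idx_inj : injective idx)
    (cidx : 'I_(d - ms) -> 'I_d) (cidx_inj : injective cidx)
    (cidx_compl : forall r : 'I_d, (r \in codom cidx) = (r \notin codom idx))
    (smp : 'I_ps -> 'I_p) (smp_inj : injective smp)
    (Uupd : 'M[R]_(d, m)) :
  let P : 'M[R]_(d, m) := unit_columns eim_idx in
  let S : 'M[R]_(d, ms) := unit_columns idx in
  let Sc : 'M[R]_(d, d - ms) := unit_columns cidx in
  let Dblk (k : 'I_p) : 'M[R]_(d, n + n) :=
    Jacobian h (A *m col k Z) *m A in
  let D := \mxrow_(k < p) Dblk k in
  let C := invmx (P^T *m U) *m P^T *m D in
  let Rs := U *m C - D in
  let D' := \mxrow_(l < ps) Dblk (smp l) in
  let C' := invmx (P^T *m U) *m P^T *m D' in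
  let Rs' := U *m C' - D' in
  let delta :=
    frobenius (S^T *m Rs) ^+ 2
    - frobenius (S^T *m (Rs - Rs' *m moore_penrose C' *m C)) ^+ 2 in
  P^T *m U \in unitmx ->
  S^T *m Uupd = S^T *m U - S^T *m Rs' *m moore_penrose C' ->
  Sc^T *m Uupd = Sc^T *m U ->
  (frobenius (Uupd *m C - D) < frobenius (U *m C - D)) <-> (0 < delta).
Proof.
move=> P S Sc Dblk D C Rs D' C' Rs' delta _ updS updSc.
have resS :
      S^T *m (Uupd *m C - D) = S^T *m (Rs - Rs' *m moore_penrose C' *m C).
  (* The identity holds for arbitrary [C], [D], [Rs'] and [C']; forgetting their bodies keeps
     distributivity from expanding them. *)
  rewrite /Rs; clearbody C D Rs' C'.
  by rewrite mulmxBr mulmxA updS mulmxBl !mulmxBr !mulmxA addrAC.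
have resSc : Sc^T *m (Uupd *m C - D) = Sc^T *m Rs.
  by rewrite /Rs !mulmxBr !(mulmxA Sc^T) updSc.
(* Squaring is strictly increasing on nonnegative numbers, so the norms may be compared through
   their squares. *)
rewrite -(ltr_pXn2r (n := 2)) ?nnegrE ?frobenius_ge0//.
rewrite !(sqr_frobenius_split _ idx_inj cidx_inj cidx_compl).
(* Both sides now share the summand from the rows in [Sc]; cancelling it leaves the two terms of
   [delta]. *)
by rewrite -/S -/Sc resS resSc ltrD2r -subr_gt0.
Qed.
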